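(* Let $(\Omega,\mathscr{F},P)$ be a finite probability space, $N$ a fixed positive integer, and $A_1,\dots,A_N$ events with $P(A_i)>0$ for every $i$. Let $\boldsymbol{c}=(c_1,\dots,c_N)^T\in\mathbb{R}^N$ satisfy $\sum_{k\in B}c_k\neq 0$ for all $B\in\mathscr{B}$. For each $i\in\{1,\dots,N\}$ put $$b^{(i)}:=\frac{\sum_{k=1}^N c_kP(A_i\cap A_k)}{c_iP(A_i)},\qquad s_i(B):=\frac{\sum_{k\in B}c_k}{c_i}\quad (B\in\mathscr{B},\ i\in B),$$ and let $B_1^{(i)},B_2^{(i)}$ be sets in $\mathscr{B}$ containing $i$ chosen as follows (all extrema being over $B\in\mathscr{B}$ with $i\in B$, subject to the additional indicated constraint): 1. If $b^{(i)}\ge 0$ and $\min_{B} s_i(B)<0$, then $B_1^{(i)}$ maximizes $s_i(B)$ subject to $s_i(B)<0$, and $B_2^{(i)}$ maximizes $s_i(B)$. 2. If $b^{(i)}\ge 0$ and $\min_{B} s_i(B)\ge 0$, then $B_1^{(i)}$ maximizes $s_i(B)$ subject to $s_i(B)\le b^{(i)}$, and $B_2^{(i)}$ minimizes $s_i(B)$ subject to $s_i(B)\ge b^{(i)}$. 3. If $b^{(i)}<0$ and $b^{(i)}<\max_{\{B:\,i\in B,\ s_i(B)<0\}}s_i(B)$, then $B_1^{(i)}$ maximizes $s_i(B)$ subject to $s_i(B)<0$, and $B_2^{(i)}$ minimizes $s_i(B)$. 4. If $b^{(i)}<0$ and $b^{(i)}\ge\max_{\{B:\,i\in B,\ s_i(B)<0\}}s_i(B)$,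 then $B_1^{(i)}$ maximizes $s_i(B)$, and $B_2^{(i)}$ maximizes $s_i(B)$ subject to $s_i(B)\le b^{(i)}$. Define $$\ell_i(\boldsymbol{c})=P(A_i)\left(\frac{c_i}{\sum_{k\in B_1^{(i)}}c_k}+\frac{c_i}{\sum_{k\in B_2^{(i)}}c_k}-\frac{c_i\sum_{k}c_kP(A_i\cap A_k)}{P(A_i)\left(\sum_{k\in B_1^{(i)}}c_k\right)\left(\sum_{k\in B_2^{(i)}}c_k\right)}\right).$$ Then $$P\left(\bigcup_{i=1}^N A_i\right)\ \ge\ \sum_{i=1}^N\ell_i(\boldsymbol{c}).$$
   Context: $\mathscr{B}$ denotes the collection of all non-empty subsets of $\{1,\dots,N\}$. The condition on $\boldsymbol{c}$ implies in particular $c_i\ne 0$ for all $i$. *)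

(* Defs.v *)
From HB Require Import structures.
From mathcomp Require Import all_boot all_order all_algebra.
From mathcomp Require Import all_classical all_reals all_analysis.

Set Implicit Arguments.
Unset Strict Implicit.
Unset Printing Implicit Defensive.

Import Order.TTheory GRing.Theory Num.Theory.

Local Open Scope classical_set_scope.
Local Open Scope ring_scope.

Section Extrema.
Context {R : realType} {N : nat}.
Implicit Types (s : {set 'I_N} -> R) (Q : pred R) (i : 'I_N).

(* Every extremum ranges over the index sets [B] containing [i] (hence
   non-empty) whose value [s B] satisfies the constraint [Q]. *)

Definition maximizes i s Q (B : {set 'I_N}) : Prop :=
  [/\ i \in B, Q (s B) & forall B' : {set 'I_N}, i \in B' -> Q (s B') -> s B' <= s B].

Definition minimizes i s Q (B : {set 'I_N}) : Prop :=
  [/\ i \in B, Q (s B) & forall B' : {set 'I_N}, i \in B' -> Q (s B') -> s B <= s B'].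

(* Extended-real values, so that the extremum over an empty family is the
   conventional [-oo] (max) or [+oo] (min). *)
Definition max_over i s Q : \bar R :=
  \big[Order.max/-oo%E]_(B : {set 'I_N} | (i \in B) && Q (s B)) (s B)%:E.

Definition min_over i s Q : \bar R :=
  \big[Order.min/+oo%E]_(B : {set 'I_N} | (i \in B) && Q (s B)) (s B)%:E.

End Extrema.

Section Bound.
Context {d : measure_display} {T : measurableType d} {R : realType}.
Context (P : probability T R) {N : nat}.
Context (A : 'I_N -> set T) (c : 'cV[R]_N).

(* A probability takes finite values, so [fine] loses nothing here. *)
Definition pr (E : set T) : R := fine (P E).

Definition csum (B : {set 'I_N}) : R := \sum_(k in B) c k 0.

Definition weighted_pr (i : 'I_N) : R := \sum_(k < N) c k 0 * pr (A i `&` A k).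

Definition b_ (i : 'I_N) : R := weighted_pr i / (c i 0 * pr (A i)).

Definition s_ (i : 'I_N) (B : {set 'I_N}) : R := csum B / c i 0.

Definition selected (i : 'I_N) (B1 B2 : {set 'I_N}) : Prop :=
  let b := b_ i in
  let s := s_ i in
  let anyv : pred R := fun=> true in
  let neg : pred R := fun x => x < 0 in
  let le_b : pred R := fun x => x <= b in
  let ge_b : pred R := fun x => b <= x in
  [/\ 0 <= b -> (min_over i s anyv < 0)%E ->
        maximizes i s neg B1 /\ maximizes i s anyv B2,
      0 <= b -> (0 <= min_over i s anyv)%E ->
        maximizes i s le_b B1 /\ minimizes i s ge_b B2,
      b < 0 -> (b%:E < max_over i s neg)%E ->
        maximizes i s neg B1 /\ minimizes i s anyv B2 &
      b < 0 -> (max_over i s neg <= b%:E)%E ->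
        maximizes i s anyv B1 /\ maximizes i s le_b B2].

Definition ell (i : 'I_N) (B1 B2 : {set 'I_N}) : R :=
  pr (A i) *
  (c i 0 / csum B1 + c i 0 / csum B2
   - (c i 0 * weighted_pr i) / (pr (A i) * csum B1 * csum B2)).

End Bound.

(* Main.v *)
(* Partition the union into atoms, [atom B] being the set of points lying in
   exactly the events [A k] with [k \in B]. Since [\sum_(i in B) 1 / s_i(B) = 1],
   the probability of the union is the sum over [i] of
   [\sum_(B | i \in B) P(atom B) / s_i(B)]. The selection of [B1], [B2] is exactly
   what puts the chord of [x |-> 1/x] through [s_i(B1)] and [s_i(B2)] below the
   graph at every attained value of [s_i]; averaging the chord instead of [1/x]
   gives [ell_i]. *)

Require Import Defs.
From HB Require Import structures.
From mathcomp Require Import all_boot all_order all_algebra.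
From mathcomp Require Import all_classical all_reals all_analysis.
From mathcomp Require Import ring lra.

Set Implicit Arguments.
Unset Strict Implicit.
Unset Printing Implicit Defensive.

Import Order.TTheory GRing.Theory Num.Theory.

Local Open Scope classical_set_scope.
Local Open Scope ring_scope.

(** * Chords of the reciprocal function *)

Section InterpolationBound.
Context {R : realType}.

(** The affine function of [s] that agrees with [s^-1] at [u] and [v]. This form avoids dividing by
    [u - v], so for [u = v] it gives the tangent at [u]. *)
Definition chord (u v s : R) : R := u^-1 + v^-1 - s / (u * v).

Lemma chordC (u v s : R) : chord u v s = chord v u s.
Proof. by rewrite /chord [v * u]mulrC [v^-1 + _]addrC. Qed.

(* The gap [s^-1 - chord u v s] equals [(s - u) (s - v) / (s u v)]. *)
Lemma chord_le_inv (u v s : R) : u != 0 -> v != 0 -> s != 0 ->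
  0 <= (s - u) * (s - v) * (s * (u * v)) -> chord u v s <= s^-1.
Proof.
move=> u0 v0 s0 h; rewrite /chord -subr_ge0.
have -> : s^-1 - (u^-1 + v^-1 - s / (u * v)) =
    (s - u) * (s - v) * (s * (u * v)) * ((s * (u * v)) ^- 2).
  by field; rewrite s0 u0 v0.
by rewrite mulr_ge0 // invr_ge0 exprn_even_ge0.
Qed.

Lemma chord_le_inv_pos (u v s : R) : 0 < u -> 0 < v -> 0 < s ->
  0 <= (s - u) * (s - v) -> chord u v s <= s^-1.
Proof.
move=> u0 v0 s0 h; apply: chord_le_inv; rewrite ?gt_eqF // mulr_ge0 //.
by rewrite !mulr_ge0 // ltW.
Qed.

(** With [u * v > 0], the product [(s - u) * (s - v)] must have the sign of [s]. A negative [s] is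
    trapped between [v] and [u]; a positive one exceeds both. *)
Lemma chord_le_inv_neg (u v s : R) : v <= u -> u < 0 -> s != 0 ->
  (s < 0 -> s <= u) -> v <= s -> chord u v s <= s^-1.
Proof.
move=> vu u0 s0 su vs; have v0 : v < 0 by exact: le_lt_trans u0.
apply: chord_le_inv; rewrite ?(lt_eqF u0) ?(lt_eqF v0) //.
rewrite mulrA [_ * s]mulrC mulr_ge0 //.
  move: s0; case: (ltgtP s 0) => // [sn|sp] _.
    by rewrite mulr_le0 ?(ltW sn) // mulr_le0_ge0 // ?subr_le0 ?su // subr_ge0.
  rewrite mulr_ge0 ?(ltW sp) // mulr_ge0 // subr_ge0; lra.
by rewrite mulr_le0 // ltW.
Qed.

(** Now [u * v < 0], so the signs must be opposite: a negative [s] lies to the left of both nodes, a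
    positive one between them. *)
Lemma chord_le_inv_opp (u v s : R) : u < 0 -> 0 < v -> s != 0 ->
  (s < 0 -> s <= u) -> s <= v -> chord u v s <= s^-1.
Proof.
move=> u0 v0 s0 su sv; apply: chord_le_inv;
  rewrite ?(lt_eqF u0) ?(gt_eqF v0) //.
rewrite mulrA [_ * s]mulrC mulr_le0 //.
  move: s0; case: (ltgtP s 0) => // [sn|sp] _.
    rewrite mulr_le0_ge0 ?(ltW sn) // mulr_le0 // subr_le0 ?su //; lra.
  rewrite mulr_ge0_le0 ?(ltW sp) // mulr_ge0_le0 // ?subr_le0 // subr_ge0; lra.
by rewrite nmulr_rle0 // ltW.
Qed.

End InterpolationBound.

(** * The selection rule yields chords below the reciprocal *)

Section SelectedBound.
Context {d : measure_display} {T : measurableType d} {R : realType}.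
Context (P : probability T R) {N : nat}.
Context (A : 'I_N -> set T) (c : 'cV[R]_N).
Hypothesis csum_neq0 : forall B : {set 'I_N}, B != finset.set0 -> csum c B != 0.

Lemma csum_mem_neq0 i (B : {set 'I_N}) : i \in B -> csum c B != 0.
Proof. by move=> iB; apply/csum_neq0/set0Pn; exists i. Qed.

Lemma c_entry_neq0 i : c i 0 != 0.
Proof.
have := @csum_mem_neq0 i [set i]%SET; rewrite /csum big_set1; apply.
by rewrite finset.inE.
Qed.

Lemma s_neq0 i (B : {set 'I_N}) : i \in B -> s_ c i B != 0.
Proof.
move=> iB.
by rewrite /s_ mulf_neq0 ?invr_neq0 ?c_entry_neq0 ?(csum_mem_neq0 iB).
Qed.

Lemma s_singleton i : s_ c i [set i]%SET = 1.
Proof. by rewrite /s_ /csum big_set1 divff // c_entry_neq0. Qed.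

(* [1] is always a value of [s_ c i], so a maximizing set has positive value. *)
Lemma maximizes_any_gt0 i (B : {set 'I_N}) :
  maximizes i (s_ c i) (fun=> true) B -> 0 < s_ c i B.
Proof.
case=> _ _ h; have := h [set i]%SET; rewrite s_singleton finset.inE eqxx.
by move=> /(_ isT isT); apply: lt_le_trans.
Qed.

(** Rules 1 and 4 give nodes of opposite sign, rule 2 two positive nodes, rule 3 two negative ones;
    each is one of the sign patterns treated above. *)
Lemma selected_chord i (B1 B2 : {set 'I_N}) :
  selected P A c i B1 B2 ->
  [/\ i \in B1, i \in B2 & forall B : {set 'I_N}, i \in B ->
    chord (s_ c i B1) (s_ c i B2) (s_ c i B) <= (s_ c i B)^-1].
Proof.
case=> h1 h2 h3 h4; case: (ltP (b_ P A c i) 0) => hb.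
- have [h|h] := ltP (b_ P A c i)%:E (max_over i (s_ c i) (fun x => x < 0)).
  + have [[iB1 neg1 max1] [iB2 _ min2]] := h3 hb h; split=> // B iB.
    by apply: chord_le_inv_neg; rewrite ?s_neq0 ?min2 //; exact: max1.
  + have [any1 [iB2 le2 max2]] := h4 hb h; have [iB1 _ max1] := any1.
    (* Rule 4 puts the positive node first, hence the swap. *)
    split=> // B iB; rewrite chordC; apply: chord_le_inv_opp.
    * exact: le_lt_trans le2 hb.
    * exact: maximizes_any_gt0 any1.
    * exact: s_neq0.
    (* Under rule 4 every negative value is at most [b_], so it competes in the maximum defining
       [B2]. *)
    * move=> neg; apply: max2 => //; rewrite -lee_fin; apply: le_trans h.
      by rewrite /max_over; apply: (le_bigmax_cond _ (fun B => (s_ c i B)%:E));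
        rewrite iB.
    * exact: max1.
- have [h|h] := ltP (min_over i (s_ c i) (fun=> true)) 0%E.
  + have [[iB1 neg1 max1] any2] := h1 hb h; have [iB2 _ max2] := any2.
    split=> // B iB; apply: chord_le_inv_opp; rewrite ?s_neq0 //.
    * exact: maximizes_any_gt0 any2.
    * exact: max1.
    * exact: max2.
  + have [[iB1 le1 max1] [iB2 ge2 min2]] := h2 hb h.
    have pos (B : {set 'I_N}) : i \in B -> 0 < s_ c i B.
      move=> iB; rewrite lt_neqAle eq_sym s_neq0 //= -lee_fin.
      apply: (le_trans h); rewrite /min_over.
      by apply: (bigmin_le_cond _ (fun B => (s_ c i B)%:E)); rewrite iB.
    split=> // B iB; apply: chord_le_inv_pos; rewrite ?pos //.
    (* The nodes are the attained values closest to [b_] on either side, so no attained value lies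
       strictly between them. *)
    have [sb|/ltW bs] := leP (s_ c i B) (b_ P A c i).
      have s1 := max1 B iB sb; have := le_trans s1 (le_trans le1 ge2).
      by move=> s2; rewrite mulr_le0 // subr_le0.
    have s2 := min2 B iB bs; have := le_trans (le_trans le1 ge2) s2.
    by move=> s1; rewrite mulr_ge0 // subr_ge0.
Qed.

End SelectedBound.

(** * Decomposition of events into atoms *)

Section Patterns.
Context {d : measure_display} {T : measurableType d} {R : realType}.
Context (P : probability T R) {N : nat} (A : 'I_N -> set T).
Hypothesis mA : forall i, measurable (A i).

Definition pattern (x : T) : {set 'I_N} := [set k | x \in A k]%SET.

Definition atom (B : {set 'I_N}) : set T := pattern @^-1` [set B].

Lemma mem_pattern x k : (k \in pattern x) = (x \in A k).
Proof. by rewrite finset.inE. Qed.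

Lemma measurable_atom B : measurable (atom B).
Proof.
have -> : atom B = \bigcap_k (if k \in B then A k else ~` A k).
  apply/seteqP; split => [x /= <- k _|x hx].
    by rewrite mem_pattern; case: ifPn => [/set_mem|/negP xA /mem_set].
  apply/setP => k; rewrite mem_pattern; have := hx k I.
  by case: ifP => _ h; [exact/mem_set | apply/negP => /set_mem].
apply: fin_bigcap_measurable => // k _.
by case: ifP => _; [exact: mA | exact: measurableC].
Qed.

(** An event depending only on the pattern is a finite disjoint union of atoms; the formulas for
    [A i], [A i] meeting [A k], and the union are instances. *)
Lemma pr_pattern (D : pred {set 'I_N}) :
  pr P [set x | D (pattern x)] = \sum_(B | D B) pr P (atom B).
Proof.
have -> : [set x | D (pattern x)] = \bigcup_(B in [set` D]) atom B.
  by apply/seteqP; split => [x Dx|x [B DB xB]];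
    [exists (pattern x) | rewrite /= xB].
rewrite /pr measure_fin_bigcup; last by move=> B _; exact: measurable_atom.
- rewrite -(bigfs _ (index_enum_uniq _));
    last by move=> B; rewrite mem_index_enum.
  rewrite sum_fine // => B _; apply: fin_num_measure; exact: measurable_atom.
- exact: finite_finset.
- by move=> B B' _ _ [x [xB xB']]; rewrite -xB -xB'.
Qed.

Lemma pr_event i : pr P (A i) = \sum_(B : {set 'I_N} | i \in B) pr P (atom B).
Proof.
rewrite -(pr_pattern (fun B => i \in B)); congr pr; apply/seteqP.
by split => x /=; rewrite mem_pattern; [exact: mem_set | exact: set_mem].
Qed.

Lemma pr_event2 i k :
  pr P (A i `&` A k) =
  \sum_(B : {set 'I_N} | (i \in B) && (k \in B)) pr P (atom B).
Proof.
rewrite -(pr_pattern (fun B => (i \in B) && (k \in B))); congr pr; apply/seteqP.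
split => x /=; rewrite !mem_pattern.
  by case=> *; apply/andP; split; exact: mem_set.
by case/andP => /set_mem ? /set_mem.
Qed.

Lemma pr_bigcup :
  pr P (\bigcup_i A i) = \sum_(B : {set 'I_N} | B != finset.set0) pr P (atom B).
Proof.
rewrite -(pr_pattern (fun B => B != finset.set0)); congr pr; apply/seteqP.
split => x /=.
  case=> i _ Aix; apply/set0Pn; exists i.
  by rewrite mem_pattern; exact: mem_set.
by case/set0Pn => i; rewrite mem_pattern => /set_mem; exists i.
Qed.

(** Exchanging the sums, an atom with [i \in B] collects [c k 0] for exactly those [k] in [B]. *)
Lemma weighted_prE (c : 'cV[R]_N) i :
  weighted_pr P A c i =
  \sum_(B : {set 'I_N} | i \in B) pr P (atom B) * csum c B.
Proof.
rewrite /weighted_pr.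
under eq_bigr do rewrite pr_event2 big_mkcondr mulr_sumr.
rewrite exchange_big /=; apply: eq_bigr => B _.
rewrite /csum mulr_sumr [RHS]big_mkcond; apply: eq_bigr => k _.
by case: ifP; rewrite ?mulr0 // mulrC.
Qed.

End Patterns.

(** * Averaging the chords over the atoms *)

Section Assembly.
Context {d : measure_display} {T : measurableType d} {R : realType}.
Context (P : probability T R) {N : nat} (A : 'I_N -> set T).
Context (c : 'cV[R]_N).
Hypothesis mA : forall i, measurable (A i).
Hypothesis pr_gt0 : forall i, 0 < pr P (A i).
Hypothesis csum_neq0 : forall B : {set 'I_N}, B != finset.set0 -> csum c B != 0.

(* [chord] is affine in its last argument, so averaging it over the patterns
   containing [i] replaces [s_ c i B] by its conditional mean [b_ i]. *)
Lemma ellE i (B1 B2 : {set 'I_N}) : i \in B1 -> i \in B2 ->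
  ell P A c i B1 B2 = \sum_(B : {set 'I_N} | i \in B)
    pr P (atom A B) * chord (s_ c i B1) (s_ c i B2) (s_ c i B).
Proof.
move=> iB1 iB2.
have [ci0 s10 s20] : [/\ c i 0 != 0, csum c B1 != 0 & csum c B2 != 0].
  by split; [exact: c_entry_neq0 | exact: csum_mem_neq0 iB1
            | exact: csum_mem_neq0 iB2].
(* Cancelling [pr P (A i)] separates the constant term of the chord, expanded by [pr_event], from
   its linear term, expanded by [weighted_prE]. *)
transitivity (pr P (A i) * (c i 0 / csum c B1 + c i 0 / csum c B2)
    - weighted_pr P A c i * (c i 0 / (csum c B1 * csum c B2))).
  by rewrite /ell; field; rewrite s10 s20 gt_eqF.
rewrite pr_event // weighted_prE // 2!mulr_suml -sumrB; apply: eq_bigr => B _.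
by rewrite /chord /s_; field; rewrite s10 s20 ci0.
Qed.

Lemma pr_bigcup_inv_s :
  pr P (\bigcup_i A i) =
  \sum_(i < N) \sum_(B : {set 'I_N} | i \in B) pr P (atom A B) * (s_ c i B)^-1.
Proof.
rewrite pr_bigcup // (exchange_big_dep (fun B => B != finset.set0)) /=;
  last first.
  by move=> i B _ iB; apply/set0Pn; exists i.
apply: eq_bigr => B B0; rewrite -mulr_sumr /s_.
under eq_bigr do rewrite invf_div.
by rewrite -mulr_suml divff ?mulr1 // csum_neq0.
Qed.

End Assembly.

Theorem theorem3p1 (R : realType) (d : measure_display) (T : measurableType d)
    (P : probability T R) (finT : finite_set [set: T])
    (N : nat) (N_gt0 : (0 < N)%N)
    (A : 'I_N -> set T)
    (mA : forall i, measurable (A i))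
    (PA_gt0 : forall i, (0 < P (A i))%E)
    (c : 'cV[R]_N)
    (c_neq0 : forall B : {set 'I_N}, B != finset.set0 -> \sum_(k in B) c k 0 != 0)
    (B1 B2 : 'I_N -> {set 'I_N})
    (hB : forall i, selected P A c i (B1 i) (B2 i)) :
  ((\sum_(i < N) ell P A c i (B1 i) (B2 i))%:E <= P (\bigcup_i A i))%E.
Proof.
have pr_gt0 i : 0 < pr P (A i).
  by apply: fine_gt0; rewrite PA_gt0 ltey_eq fin_num_measure.
rewrite -[leRHS]fineK; last first.
  by apply: fin_num_measure; apply: fin_bigcup_measurable.
rewrite lee_fin -/(pr P _) (pr_bigcup_inv_s P mA c_neq0).
apply: ler_sum => i _.
have [iB1 iB2 le_chord] := selected_chord c_neq0 (hB i).
rewrite (ellE mA pr_gt0 c_neq0 iB1 iB2); apply: ler_sum => B iB.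
by rewrite ler_wpM2l ?le_chord // fine_ge0.
Qed.
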